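(* For every matrix algebra $\Lambda\subset k^{n\times n}$ (a subspace closed under multiplication and containing $I_n$), there exists a nonsingular matrix $P$ such that $P^{-1}\Lambda P=\{P^{-1}AP\mid A\in\Lambda\}$ is a reduced matrix algebra.
   Context: $k$ is an algebraically closed field. For $\underline n=(n_1,\dots,n_t)$ with $n_i\in\{0,1,2,\dots\}$, an $\underline n\times\underline n$ matrix is a matrix $S=[S_{ij}]_{i,j=1}^t$ partitioned into blocks $S_{ij}\in k^{n_i\times n_j}$. An algebra $\Lambda$ of $\underline n\times\underline n$ matrices is a reduced $\underline n\times\underline n$ algebra if there exist an equivalence relation $\sim$ on $T=\{1,\dots,t\}$ and, for each pair $(\mathcal I,\mathcal J)$ of equivalence classes, a finite system of linear equations $\sum_{\mathcal I\ni i<j\in\mathcal J}c^{(l)}_{ij}x_{ij}=0$ ($1\le l\le q_{\mathcal I\mathcal J}$, $c^{(l)}_{ij}\in k$), such that $\Lambda$ consists exactly of all upper block-triangular $\underline n\times\underline n$ matrices $S$ ($S_{ij}=0$ for $i>j$) with $S_{ii}=S_{jj}$ whenever $i\sim j$ and $\sum_{\mathcal I\ni i<j\in\mathcal J}c^{(l)}_{ij}S_{ij}=0$ for all $\mathcal I,\mathcal J,l$. A reduced matrix algebra is a reduced $\underline n\times\underline n$ algebra for some $\underline n$. *)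

(* Defs.v *)
From HB Require Import structures.
From mathcomp Require Import all_boot all_order all_algebra.
From Stdlib Require List.
Set Implicit Arguments. Unset Strict Implicit. Unset Printing Implicit Defensive.
Import GRing.Theory.
Local Open Scope ring_scope.

(* Entry (r, c) of an n x n matrix, addressed by natural numbers (0 if out of range). *)
Definition mx_at (k : nzRingType) (n : nat) (S : 'M[k]_n) (r c : nat) : k :=
  oapp (fun i : 'I_n => oapp (fun j : 'I_n => S i j) 0 (insub c)) 0 (insub r).

Definition blk_off (t : nat) (ns : 'I_t -> nat) (i : 'I_t) : nat :=
  (\sum_(l < t | (l < i)%N) ns l)%N.

(* Entry (a, b) of the block S_ij (meaningful for a < ns i, b < ns j). *)
Definition blk_at (k : nzRingType) (n t : nat) (ns : 'I_t -> nat) (S : 'M[k]_n)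
    (i j : 'I_t) (a b : nat) : k :=
  mx_at S (blk_off ns i + a) (blk_off ns j + b).

(* The data of a reduced ns x ns algebra:
   - ns : 'I_t -> nat is the partition (sum ns = n),
   - eqv is an equivalence relation on T = 'I_t (blocks in one class have equal size,
     as required for S_ii = S_jj to make sense),
   - eqs is the finite list of linear equations; an entry ((i0, j0), c) is the equation
     sum_{i ~ i0, j ~ j0, i < j} c i j * S_ij = 0 attached to the pair of classes
     (class of i0, class of j0). *)
Definition reduced_algebra_of (k : nzRingType) (n t : nat) (ns : 'I_t -> nat)
    (eqv : rel 'I_t) (eqs : seq (('I_t * 'I_t) * ('I_t -> 'I_t -> k)))
    (L : 'M[k]_n -> Prop) : Prop :=
  (\sum_(i < t) ns i)%N = n /\
  (forall i, eqv i i) /\ (forall i j, eqv i j -> eqv j i) /\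
  (forall i j l, eqv i j -> eqv j l -> eqv i l) /\
  (forall i j, eqv i j -> ns i = ns j) /\
  forall S : 'M[k]_n, L S <->
    [/\
        (forall i j : 'I_t, (j < i)%N -> forall a b, (a < ns i)%N -> (b < ns j)%N ->
           blk_at ns S i j a b = 0),
        (forall i j : 'I_t, eqv i j -> forall a b, (a < ns i)%N -> (b < ns i)%N ->
           blk_at ns S i i a b = blk_at ns S j j a b) &
        (forall e, List.In e eqs -> forall a b, (a < ns e.1.1)%N -> (b < ns e.1.2)%N ->
           \sum_(i < t | eqv i e.1.1) \sum_(j < t | eqv j e.1.2 && (i < j)%N)
              e.2 i j * blk_at ns S i j a b = 0)].

Definition reduced_matrix_algebra (k : nzRingType) (n : nat) (L : 'M[k]_n -> Prop) : Prop :=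
  exists t (ns : 'I_t -> nat) (eqv : rel 'I_t) eqs, reduced_algebra_of ns eqv eqs L.

Definition matrix_algebra (k : nzRingType) (n : nat) (L : 'M[k]_n -> Prop) : Prop :=
  [/\ L 0, (forall A B, L A -> L B -> L (A + B)),
      (forall (c : k) A, L A -> L (c *: A)),
      (forall A B, L A -> L B -> L (A *m B)) & L 1%:M].

(* Main.v *)
Require Import Defs.
From Stdlib Require Import Classical.
From mathcomp Require Import all_boot all_order all_algebra.
Set Implicit Arguments. Unset Strict Implicit. Unset Printing Implicit Defensive.
Import GRing.Theory.
Local Open Scope ring_scope.


(* Let L act on row vectors, and write 1 as a sum of primitive orthogonal idempotents y_p x_p of
   L, where x_p y_p = e_p is a chosen representative of the isomorphism class of y_p x_p. As k is
   algebraically closed, e_p a e_q lies in the radical of L up to a multiple of e_p, which occurs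
   only for e_p = e_q. For each step W' < W of a composition series of k^n there is a vector v in
   W outside W' that is fixed by one of the e: the v x_p with e_p = e are a basis of W modulo W',
   and v * rad L lies in W'. In the basis of all these v x_p the blocks are the composition
   factors, two of them being equivalent when they have the same e; L becomes block triangular
   with equal equivalent diagonal blocks, and contains the images of the y_p x_q, which are block
   diagonal with the same elementary matrix in each block of a class. Multiplication by these
   reduces membership in L to conditions on a single entry position (a, b) of the blocks, where
   they are linear equations for each pair of classes. *)

(** * Subspaces given by predicates, Fitting idempotents, linear equations *)

Lemma maximal_vspace (k : fieldType) (V : vectType k) (Q : {vspace V} -> Prop) U0 :
  Q U0 -> exists U, Q U /\ forall U', Q U' -> (U <= U')%VS -> U' = U.
Proof.
have [m] := ubnP (\dim {:V} - \dim U0).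
elim: m U0 => // m IHm U0 ltU0 QU0.
have [[U [QU sU neU]]|nex] := classic (exists U, [/\ Q U, (U0 <= U)%VS & U != U0]).
  apply: (IHm U) => //; have ltU : (\dim U0 < \dim U)%N.
    have [le0 eq0] := dimv_leqif_eq sU.
    by rewrite ltn_neqAle le0 andbT eq0 eq_sym.
  have leU := dimvS (subvf U); move: ltU0; rewrite !ltnS; apply: leq_trans.
  by rewrite ltn_sub2l // (leq_trans ltU).
exists U0; split=> // U QU sU; apply/eqP/idPn=> neU.
by apply: nex; exists U.
Qed.

(** A maximal subspace inside [Q] is all of [Q]: the line through any [u] with [Q u] can be added to
    it without leaving [Q]. *)
Lemma vspace_of_pred (k : fieldType) (V : vectType k) (Q : V -> Prop) :
  Q 0 -> (forall u v, Q u -> Q v -> Q (u + v)) -> (forall c u, Q u -> Q (c *: u)) ->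
  exists U : {vspace V}, forall u, u \in U <-> Q u.
Proof.
move=> Q0 QD QZ; pose P (U : {vspace V}) := forall u, u \in U -> Q u.
have [|U [PU maxU]] := @maximal_vspace k V P 0%VS.
  by move=> u; rewrite memv0 => /eqP->.
exists U => u; split=> [/PU //|Qu].
rewrite -(maxU (U + <[u]>)%VS) ?addvSl //.
  by apply: (subvP (addvSr U _)); apply: memv_line.
by move=> w /memv_addP[a /PU Qa [b /vlineP[c ->] ->]]; apply: QD => //; apply: QZ.
Qed.

(* With char_poly y = 'X^m * q and q coprime to 'X, the idempotent is the multiple
   of 'X^m.+1 in a Bezout relation between 'X^(m.+1) and q. *)
Lemma fitting (k : fieldType) n (y : 'M[k]_n.+1) :
  exists r : {poly k}, let h := y * horner_mx y r in
    h * h = h /\ exists m, y ^+ m * h = y ^+ m.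
Proof.
have [m [q +]] := multiplicity_XsubC (char_poly y) 0.
rewrite (monic_neq0 (char_poly_monic y)) /= subr0 => qn0 Ep.
have /Bezout_eq1_coprimepP[[u v] /= Euv] : coprimep ('X^(m.+1)) q.
  by rewrite coprimep_expl // coprimep_sym -['X]subr0 coprimep_XsubC.
exists (u * 'X^m) => /=.
have -> : y * horner_mx y (u * 'X^m) = horner_mx y (u * 'X^(m.+1)).
  by rewrite -{1}(horner_mx_X y) -rmorphM /= mulrCA -exprS.
have CH : horner_mx y (q * 'X^m) = 0 by rewrite -Ep Cayley_Hamilton.
have Ey j : y ^+ j = horner_mx y 'X^j by rewrite rmorphXn /= horner_mx_X.
have E : u * 'X^(m.+1) = 1 - v * q by rewrite -Euv addrK.
split.
  rewrite -rmorphM /= {2}E mulrBr mulr1 rmorphB /=.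
  have -> : u * 'X^(m.+1) * (v * q) = u * 'X * v * (q * 'X^m).
    by rewrite exprS !mulrA -!(mulrAC _ 'X^m) -!(mulrAC _ q).
  by rewrite (rmorphM _ _ (q * _)) /= CH mulr0 subr0.
exists m; rewrite Ey -rmorphM /= E mulrBr mulr1 rmorphB /=.
by rewrite (mulrC 'X^m) -mulrA (rmorphM _ _ (q * _)) /= CH mulr0 subr0.
Qed.

(* Coefficient systems are functions, without decidable equality, so the lists of equations
   are handled through List.In instead of \in. *)
Lemma In_map A B (f : A -> B) s y :
  List.In y (map f s) <-> exists x, List.In x s /\ y = f x.
Proof.
elim: s => [|a s IHs] /=; first by split=> // -[x []].
rewrite IHs; split=> [[<-|[x [sx ->]]]|[x [[<-|sx] ->]]].
- by exists a; split; first by left.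
- by exists x; split; first by right.
- by left.
- by right; exists x.
Qed.

Lemma In_flatten A (ss : seq (seq A)) y :
  List.In y (flatten ss) <-> exists s, List.In s ss /\ List.In y s.
Proof.
elim: ss => [|s ss IHss] /=; first by split=> // -[s []].
have In_cat (s1 s2 : seq A) : List.In y (s1 ++ s2) <-> List.In y s1 \/ List.In y s2.
  by elim: s1 => [|a s1 IHs] /=; [split=> [|[]]; auto | rewrite IHs; tauto].
rewrite In_cat IHss; split=> [[sy|[r [ssr ry]]]|[r [[<-|ssr] ry]]].
- by exists s; split; first by left.
- by exists r; split; first by right.
- by left.
- by right; exists r.
Qed.

Lemma In_memP (A : eqType) (s : seq A) x : List.In x s <-> x \in s.
Proof.
elim: s => //= a s IHs; rewrite inE IHs; split=> [[->|->]|/predU1P[->|]]; rewrite ?eqxx ?orbT //.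
- by left.
- by right.
Qed.

(** [U] is the kernel of the complementary projection [g]. Entry [ab] of [g M] is a linear form in
    the entries of [M], its coefficients [cf ab] being read off from the elementary matrices. *)
Lemma vspace_mx_equations (k : fieldType) t (U : {vspace 'M[k]_t}) :
  exists cs : seq ('I_t -> 'I_t -> k), forall M, M \in U <->
    forall c, List.In c cs -> \sum_i \sum_j c i j * M i j = 0.
Proof.
pose g (M : 'M[k]_t) := M - projv U M.
pose cf (ab : 'I_t * 'I_t) i j := g (delta_mx i j) ab.1 ab.2.
have gE M a b : g M a b = \sum_i \sum_j cf (a, b) i j * M i j.
  rewrite {1}/g {1 2}[M]matrix_sum_delta linear_sum -sumrB !summxE.
  apply: eq_bigr => i _; rewrite linear_sum -sumrB summxE; apply: eq_bigr => j _.
  by rewrite linearZ /= -scalerBr mxE mulrC.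
exists (map cf (enum {: 'I_t * 'I_t})) => M; split=> [UM c /In_map[[a b] [_ ->]]|cM].
  by rewrite -gE /g projv_id // subrr mxE.
suff g0 : g M = 0 by rewrite -(subrK (projv U M) M) -/(g M) g0 add0r memv_proj.
apply/matrixP=> a b; rewrite gE mxE; apply: cM; apply/In_map; exists (a, b); split=> //.
by apply/In_memP; rewrite mem_enum.
Qed.

(** * Block indices, and matrices spread over equivalent blocks *)

Section Blocks.
Context (k : fieldType) (n t : nat) (ns : 'I_t -> nat) (Hn : (\sum_(i < t) ns i)%N = n).

Definition blk (r : 'I_n) : 'I_t := tagnat.sig1 (cast_ord (esym Hn) r).
Definition pos (r : 'I_n) : nat := tagnat.sig2 (cast_ord (esym Hn) r).

Lemma val_blk (r : 'I_n) : r = (blk_off ns (blk r) + pos r)%N :> nat.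
Proof. by rewrite -[LHS]/(nat_of_ord (cast_ord (esym Hn) r)) tagnat.rect. Qed.

Lemma pos_lt r : (pos r < ns (blk r))%N.
Proof. exact: ltn_ord. Qed.

Lemma blk_pos_inj r s : blk r = blk s -> pos r = pos s -> r = s.
Proof. by move=> Eb Ep; apply: val_inj; rewrite /= val_blk Eb Ep -val_blk. Qed.

Lemma index_of i a : (a < ns i)%N -> exists r, blk r = i /\ pos r = a.
Proof.
move=> lta; exists (cast_ord Hn (@tagnat.Rank _ ns i (Ordinal lta))).
by rewrite /blk /pos cast_ordK; split; [rewrite tagnat.Rank1K | rewrite tagnat.Rank2K].
Qed.

Lemma blk_atE (S : 'M[k]_n) r c : blk_at ns S (blk r) (blk c) (pos r) (pos c) = S r c.
Proof. by rewrite /blk_at /mx_at -!val_blk !valK. Qed.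

Context (eqv : rel 'I_t) (eqv_refl : reflexive eqv)
  (eqv_sym : forall i j, eqv i j -> eqv j i)
  (eqv_trans : forall i j l, eqv i j -> eqv j l -> eqv i l)
  (eqv_ns : forall i j, eqv i j -> ns i = ns j).

Definition same (r s : 'I_n) := eqv (blk r) (blk s) && (pos r == pos s).

(** Block diagonal: the same elementary matrix in every diagonal block of one class, and zero if
    [blk r0] and [blk c0] are not equivalent. *)
Definition unit_mx r0 c0 : 'M[k]_n :=
  \matrix_(r, c) ((blk r == blk c) && same r r0 && same c c0)%:R.

(** Only the summand at [r'] survives: in each block of the class, the row at position [pos r0]
    moves to [pos r1] and all other rows are killed. *)
Lemma unit_mul (S : 'M[k]_n) r1 r0 r c r' :
    eqv (blk r0) (blk r1) -> blk r' = blk r -> pos r' = pos r0 ->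
  (unit_mx r1 r0 *m S) r c = if same r r1 then S r' c else 0.
Proof.
move=> e01 Eb Ep; rewrite mxE (bigD1 r') //= big1 => [|s nrs]; rewrite !mxE.
  rewrite addr0 Eb eqxx /=; case: ifP => [/andP[er _]|_]; last by rewrite mul0r.
  by rewrite /same Eb Ep eqxx andbT (eqv_trans er (eqv_sym e01)) mul1r.
case: eqP => [Ers|_] /=; last by rewrite mul0r.
rewrite [same s r0]/same; case: (pos s =P pos r0) => [Esp|_]; last by rewrite !andbF mul0r.
by case/eqP: nrs; apply: blk_pos_inj; rewrite ?Eb ?Ep.
Qed.

Lemma mul_unit (S : 'M[k]_n) c0 c1 r c c' :
    eqv (blk c0) (blk c1) -> blk c' = blk c -> pos c' = pos c0 ->
  (S *m unit_mx c0 c1) r c = if same c c1 then S r c' else 0.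
Proof.
move=> e01 Eb Ep; rewrite mxE (bigD1 c') //= big1 => [|s nrs]; rewrite !mxE.
  rewrite addr0 Eb eqxx /=; case: ifP => [/andP[er _]|_]; last by rewrite andbF mulr0.
  by rewrite /same Eb Ep eqxx !andbT (eqv_trans er (eqv_sym e01)) mulr1.
case: (blk s =P blk c) => [Ers|_] /=; last by rewrite mulr0.
rewrite [same s c0]/same; case: (pos s =P pos c0) => [Esp|_]; last by rewrite !andbF mulr0.
by case/eqP: nrs; apply: blk_pos_inj; rewrite ?Eb ?Ep.
Qed.

Lemma unit_mul0 (S : 'M[k]_n) r1 r0 r c : ~~ same r r1 -> (unit_mx r1 r0 *m S) r c = 0.
Proof. by move=> nr; rewrite mxE big1 // => s _; rewrite mxE (negPf nr) andbF mul0r. Qed.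

Lemma mul_unit0 (S : 'M[k]_n) c0 c1 r c : ~~ same c c1 -> (S *m unit_mx c0 c1) r c = 0.
Proof. by move=> nc; rewrite mxE big1 // => s _; rewrite mxE (negPf nc) andbF mulr0. Qed.

Definition emb (M : 'M[k]_t) a b : 'M[k]_n :=
  \matrix_(r, c) if (pos r == a) && (pos c == b) then M (blk r) (blk c) else 0.

Definition trunc (S : 'M[k]_n) i0 j0 a b : 'M[k]_t :=
  \matrix_(i, j) if [&& eqv i i0, eqv j j0 & (i < j)%N] then blk_at ns S i j a b else 0.

(** For [r0], [r1] and [c0], [c1] in equivalent blocks this is
    [unit_mx r1 r0 *m S *m unit_mx c0 c1], written entrywise for comparison with [emb] and
    [trunc]. *)
Definition corner (S : 'M[k]_n) r0 c0 r1 c1 : 'M[k]_n :=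
  \matrix_(r, c) if same r r1 && same c c1 then
    blk_at ns S (blk r) (blk c) (pos r0) (pos c0) else 0.

Definition block_triangular (S : 'M[k]_n) :=
  (forall r c, (blk c < blk r)%N -> S r c = 0) /\
  forall r c r' c', blk r = blk c -> blk r' = blk c' -> same r r' -> same c c' -> S r c = S r' c'.

(** Blocks below the diagonal vanish and those above it give [trunc]. Diagonal blocks occur only if
    the two classes coincide; they all carry the same scalar and so form a multiple of
    [unit_mx r1 c1]. *)
Lemma cornerE S r0 c0 r1 c1 : block_triangular S ->
  eqv (blk r0) (blk r1) -> eqv (blk c0) (blk c1) ->
  corner S r0 c0 r1 c1 = emb (trunc S (blk r1) (blk c1) (pos r0) (pos c0)) (pos r1) (pos c1)
    + (if eqv (blk r1) (blk c1) then blk_at ns S (blk r1) (blk r1) (pos r0) (pos c0) else 0)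
      *: unit_mx r1 c1.
Proof.
move=> [triS diagS] er ec; apply/matrixP=> r c; rewrite !mxE.
rewrite /same; case: (pos r == _); last by rewrite !andbF /= mulr0 addr0.
case: (pos c == _); last by rewrite !andbF mulr0 addr0.
rewrite !andbT /=.
have [err|] := boolP (eqv (blk r) (blk r1)); last by rewrite andbF /= mulr0 addr0.
have [ecc|] := boolP (eqv (blk c) (blk c1)); last by rewrite !andbF /= mulr0 addr0.
rewrite /= !andbT.
have [r' [br pr]] : exists r', blk r' = blk r /\ pos r' = pos r0.
  by apply: index_of; rewrite (eqv_ns err) -(eqv_ns er) pos_lt.
have [c' [bc pc]] : exists c', blk c' = blk c /\ pos c' = pos c0.
  by apply: index_of; rewrite (eqv_ns ecc) -(eqv_ns ec) pos_lt.
have Src : blk_at ns S (blk r) (blk c) (pos r0) (pos c0) = S r' c'.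
  by rewrite -br -bc -pr -pc blk_atE.
have [lt|gt|/val_inj eq] := ltngtP (blk r) (blk c).
- by rewrite -val_eqE ltn_eqF // mulr0 addr0.
- by rewrite Src triS ?br ?bc // -val_eqE gtn_eqF // mulr0 addr0.
rewrite Src eq eqxx mulr1 add0r.
have e11 : eqv (blk r1) (blk c1) by rewrite (eqv_trans (eqv_sym err)) // eq.
have [r2 [br2 pr2]] : exists r2, blk r2 = blk r1 /\ pos r2 = pos r0.
  by apply: index_of; rewrite -(eqv_ns er) pos_lt.
have [c2 [bc2 pc2]] : exists c2, blk c2 = blk r1 /\ pos c2 = pos c0.
  by apply: index_of; rewrite (eqv_ns e11) -(eqv_ns ec) pos_lt.
rewrite e11 -{1}br2 -{1}bc2 -pr2 -pc2 blk_atE.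
apply: diagS; rewrite ?br ?bc ?bc2 //
  /same ?br ?bc ?br2 ?bc2 ?pr ?pc ?pr2 ?pc2 ?err ?eqxx ?andbT //.
by rewrite -eq.
Qed.

(** * From single entry positions of the blocks to a reduced algebra *)

Context (L : 'M[k]_n -> Prop) (L0 : L 0) (LD : forall A B, L A -> L B -> L (A + B))
  (LZ : forall c A, L A -> L (c *: A)) (LM : forall A B, L A -> L B -> L (A *m B)).
Context (Lunit : forall r c, eqv (blk r) (blk c) -> L (unit_mx r c))
  (Ltri : forall S, L S -> block_triangular S).

Lemma LB A B : L A -> L B -> L (A - B).
Proof. by move=> LA ?; rewrite -scaleN1r; apply/LD/LZ. Qed.

(** Membership is demanded at every position [(a, b)], so that one system of equations per pair of
    classes serves all entries of the blocks. *)
Definition corner_space i0 j0 (M : 'M[k]_t) :=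
  (forall i j, ~~ [&& eqv i i0, eqv j j0 & (i < j)%N] -> M i j = 0) /\
  forall a b, (a < ns i0)%N -> (b < ns j0)%N -> L (emb M a b).

Lemma corner_space_equations i0 j0 :
  exists cs : seq ('I_t -> 'I_t -> k), forall M, corner_space i0 j0 M <->
    forall c, List.In c cs -> \sum_i \sum_j c i j * M i j = 0.
Proof.
have [|M M' [sM eM] [sM' eM']|c M [sM eM]|U UE] := @vspace_of_pred k _ (corner_space i0 j0).
- split=> [i j _|a b _ _]; first by rewrite mxE.
  suff -> : emb 0 a b = 0 by [].
  by apply/matrixP=> r c; rewrite !mxE if_same.
- split=> [i j nij|a b lta ltb]; first by rewrite mxE sM ?sM' ?addr0.
  suff -> : emb (M + M') a b = emb M a b + emb M' a b by apply: LD; [apply: eM | apply: eM'].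
  by apply/matrixP=> r c; rewrite !mxE; case: ifP; rewrite ?addr0.
- split=> [i j nij|a b lta ltb]; first by rewrite mxE sM ?mulr0.
  suff -> : emb (c *: M) a b = c *: emb M a b by apply/LZ/eM.
  by apply/matrixP=> r d; rewrite !mxE; case: ifP; rewrite ?mulr0.
have [cs csE] := vspace_mx_equations U.
by exists cs => M; rewrite -UE.
Qed.

(** Multiplying [S] by unit matrices of [L] moves its entries to any position [(a, b)]; by [cornerE]
    the result differs from the embedded [trunc] by a multiple of a unit matrix, which is 0 or lies
    in [L]. *)
Lemma corner_space_trunc S r0 c0 : L S -> corner_space (blk r0) (blk c0)
  (trunc S (blk r0) (blk c0) (pos r0) (pos c0)).
Proof.
move=> LS; split=> [i j|a b lta ltb]; first by rewrite mxE => /negPf->.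
have [r1 [br pr]] := index_of lta; have [c1 [bc pc]] := index_of ltb.
have er : eqv (blk r0) (blk r1) by rewrite br.
have ec : eqv (blk c0) (blk c1) by rewrite bc.
have := cornerE (Ltri LS) er ec; rewrite br bc pr pc => /eqP; rewrite -subr_eq => /eqP <-.
apply: LB; last by case: ifP => e; rewrite ?scale0r //; apply/LZ/Lunit; rewrite br bc.
suff -> : corner S r0 c0 r1 c1 = unit_mx r1 r0 *m S *m unit_mx c0 c1.
  by apply: (LM (LM _ LS)); apply: Lunit; rewrite ?bc ?br.
apply/matrixP=> r c; rewrite mxE; case: ifP => [/andP[sr sc]|].
  have [r' [br' pr']] : exists r', blk r' = blk r /\ pos r' = pos r0.
    by apply: index_of; have /andP[/eqv_ns-> _] := sr; rewrite br pos_lt.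
  have [c' [bc' pc']] : exists c', blk c' = blk c /\ pos c' = pos c0.
    by apply: index_of; have /andP[/eqv_ns-> _] := sc; rewrite bc pos_lt.
  rewrite (mul_unit _ _ ec bc' pc') sc (unit_mul _ _ er br' pr') sr.
  by rewrite -br' -bc' -pr' -pc' blk_atE.
move=> /negbT; rewrite negb_and => /orP[nr|nc]; last by rewrite mul_unit0.
by rewrite -mulmxA unit_mul0.
Qed.

Lemma same_sym r s : same r s -> same s r.
Proof. by case/andP=> e /eqP p; rewrite /same p eqxx eqv_sym. Qed.

Lemma same_trans r s u : same r s -> same s u -> same r u.
Proof. by case/andP=> e /eqP p /andP[e' /eqP p']; rewrite /same p p' eqxx (eqv_trans e e'). Qed.

(** [pick] depends only on the extension of its predicate, so the fixed points of [rep] meet each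
    class of [same] exactly once. *)
Definition rep (r : 'I_n) := odflt r [pick s | same r s].

Lemma same_rep r : same r (rep r).
Proof. by rewrite /rep; case: pickP => //= /(_ r); rewrite /same eqv_refl eqxx. Qed.

Lemma eq_rep r s : same r s -> rep r = rep s.
Proof.
move=> rs; rewrite /rep; have E : same r =1 same s.
  by move=> u; apply/idP/idP; apply: same_trans; rewrite ?(same_sym rs).
rewrite (eq_pick E); case: pickP => //= /(_ s).
by rewrite /same eqv_refl eqxx.
Qed.

Lemma rep_rep r : rep (rep r) == rep r.
Proof. by rewrite -(eq_rep (same_rep r)). Qed.

Lemma reduced_of_corner_spaces : exists eqs, reduced_algebra_of ns eqv eqs L.
Proof.
have /fin_all_exists[cs csE] (ij : 'I_t * 'I_t) := corner_space_equations ij.1 ij.2.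
exists (flatten [seq [seq (ij, c) | c <- cs ij] | ij <- enum {: 'I_t * 'I_t}]).
have eqsE e : List.In e (flatten [seq [seq (ij, c) | c <- cs ij] | ij <- enum {: 'I_t * 'I_t}])
    <-> List.In e.2 (cs e.1).
  case: e => ij c /=; rewrite In_flatten; split.
    by move=> [_ [/In_map[ij' [_ ->]] /In_map[c' [? [-> ->]]]]].
  move=> cc; exists [seq (ij, c) | c <- cs ij]; split; apply/In_map; last by exists c.
  by exists ij; split=> //; apply/In_memP; rewrite mem_enum.
have sumE S i0 j0 a b (c : 'I_t -> 'I_t -> k) :
    \sum_(i < t | eqv i i0) \sum_(j < t | eqv j j0 && (i < j)%N) c i j * blk_at ns S i j a b
    = \sum_i \sum_j c i j * trunc S i0 j0 a b i j.
  rewrite big_mkcond; apply: eq_bigr => i _; case: ifP => [ei|nei].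
    rewrite big_mkcond; apply: eq_bigr => j _; rewrite mxE ei /=.
    by case: ifP; rewrite ?mulr0.
  by rewrite big1 // => j _; rewrite mxE nei mulr0.
split=> //; split=> //; split=> //; split=> //; split=> // S; split=> [LS|[triS diagS eqsS]].
  have [triS diagS] := Ltri LS; split.
  - move=> i j ltji a b /index_of[r [br pr]] /index_of[c [bc pc]].
    by rewrite -br -bc -pr -pc blk_atE triS // br bc.
  - move=> i j eij a b lta ltb.
    have [r [br pr]] := index_of lta; have [c [bc pc]] := index_of ltb.
    move: lta ltb; rewrite (eqv_ns eij) => /index_of[r' [br' pr']] /index_of[c' [bc' pc']].
    rewrite -{1}br -{1}bc -pr -pc blk_atE pr pc -{1}br' -{1}bc' -pr' -pc' blk_atE.
    by apply: diagS; rewrite ?br ?bc ?br' ?bc' //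
      /same ?br ?bc ?br' ?bc' ?pr ?pc ?pr' ?pc' eij eqxx.
  - move=> [[i0 j0] c] /eqsE /= cc a b /index_of[r [br pr]] /index_of[d [bd pd]].
    rewrite sumE; apply: (proj1 (csE (i0, j0) _)) cc => /=.
    by rewrite -br -bd -pr -pd; apply: corner_space_trunc.
have bt : block_triangular S.
  split=> [r c lt|r c r' c' rc rc' /andP[er /eqP pr] /andP[_ /eqP pc]].
    by rewrite -blk_atE triS ?pos_lt.
  rewrite -!blk_atE -rc -rc' pr pc; apply: diagS => //; rewrite ?(eqv_ns er) ?pos_lt //.
  by rewrite rc' pos_lt.
(* By [cornerE]: the equations put the embedded [trunc] into [L], and the diagonal part is a
   multiple of a unit matrix. *)
have LS r0 c0 : L (corner S r0 c0 r0 c0).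
  rewrite cornerE //; apply: LD; last first.
    by case: ifP => e; rewrite ?scale0r //; apply/LZ/Lunit.
  have [_] : corner_space (blk r0) (blk c0) (trunc S (blk r0) (blk c0) (pos r0) (pos c0)).
    apply/(csE (blk r0, blk c0)) => c cc; rewrite -sumE.
    by apply: (eqsS (blk r0, blk c0, c)); rewrite ?pos_lt //; apply/eqsE.
  by apply; apply: pos_lt.
(* Entry [(r, c)] of [S] occurs in one corner only, that of [(rep r, rep c)]. *)
have -> : S = \sum_(r0 | rep r0 == r0) \sum_(c0 | rep c0 == c0) corner S r0 c0 r0 c0.
  apply/matrixP=> r c; rewrite summxE (bigD1 (rep r)) ?rep_rep //=.
  rewrite summxE (bigD1 (rep c)) ?rep_rep //= mxE !same_rep /=.
  have /andP[_ /eqP <-] := same_rep r; have /andP[_ /eqP <-] := same_rep c.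
  rewrite blk_atE !big1 ?addr0 // => [r0 /andP[/eqP r0E nr0]|c0 /andP[/eqP c0E nc0]].
    rewrite summxE big1 // => c0 _; rewrite mxE.
    by case: ifP => // /andP[/eq_rep E _]; rewrite E r0E eqxx in nr0.
  by rewrite mxE; case: ifP => // /andP[_ /eq_rep E]; rewrite E c0E eqxx in nc0.
by elim/big_ind: _ => // r0 _; elim/big_ind: _ => // c0 _; exact: LS.
Qed.

End Blocks.

(** * Primitive idempotents and their equivalence *)

Section MatrixAlgebra.
Context (k : closedFieldType) (n : nat) (L : {vspace 'M[k]_n.+1}).
Hypotheses (L1 : 1 \in L) (LM : forall a b, a \in L -> b \in L -> a * b \in L).

Definition nilp (a : 'M[k]_n.+1) := exists m, a ^+ m = 0.

Lemma LX a m : a \in L -> a ^+ m \in L.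
Proof. by move=> La; elim: m => // m IHm; rewrite exprS LM. Qed.

Lemma L_horner a r : a \in L -> horner_mx a r \in L.
Proof.
move=> La; elim/poly_ind: r => [|r c IHr]; first by rewrite rmorph0 mem0v.
rewrite rmorphD rmorphM /= horner_mx_X horner_mx_C rpredD ?LM //.
by rewrite -[c%:M]scalemx1 memvZ.
Qed.

Lemma nilp_swap a b : nilp (a * b) -> nilp (b * a).
Proof.
case=> m Em; exists m.+1.
suff -> : (b * a) ^+ m.+1 = b * (a * b) ^+ m * a by rewrite Em mulr0 mul0r.
by elim: (m) => [|j IHj]; rewrite ?mulr1 // exprS IHj exprS !mulrA.
Qed.

Definition primitive (e : 'M[k]_n.+1) :=
  [/\ e \in L, e * e = e, e != 0 &
      forall h, h \in L -> h * h = h -> e * h = h -> h * e = h -> h = 0 \/ h = e].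

(** The Fitting idempotent of [u] lies in [e L e], so it is 0 or [e]. The value 0 would make [u]
    nilpotent; the value [e] is [u] times a polynomial in [u]. *)
Lemma primitive_inv e u : primitive e -> u \in L -> e * u = u -> u * e = u ->
  ~ nilp u -> exists w, [/\ w \in L, e * w = w, w * e = w & u * w = e].
Proof.
move=> [Le ee en0 prim] Lu eu ue nnil.
have [r [/= hh [m Em]]] := fitting u; set h := u * _ in hh Em.
have Lr := L_horner r Lu.
have cu : u * horner_mx u r = horner_mx u r * u.
  by rewrite -{1 4}(horner_mx_X u) -!rmorphM /= mulrC.
have [||||h0|he] := prim h; rewrite ?LM //.
- by rewrite /h mulrA eu.
- by rewrite /h cu -mulrA ue.
- by case: nnil; exists m; rewrite -Em h0 mulr0.
exists (e * horner_mx u r * e); split; rewrite ?LM //.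
- by rewrite !mulrA ee.
- by rewrite -!mulrA ee.
by rewrite !mulrA ue -/h he ee.
Qed.

(** The characteristic polynomial splits into factors [y - c]. If no [y - c *: e] were nilpotent,
    all would be invertible in [e L e], and cancelling them one by one from Cayley-Hamilton would
    leave [e = 0]. *)
Lemma primitive_eigenvalue e y : primitive e -> y \in L -> e * y = y -> y * e = y ->
  exists c, nilp (y - c *: e).
Proof.
move=> pe Ly ey ye; have [Le ee en0 _] := pe.
have [s Es] := closed_field_poly_normal (char_poly y).
rewrite (monicP (char_poly_monic y)) scale1r in Es.
have : horner_mx y (\prod_(z <- s) ('X - z%:P)) * e = 0.
  by rewrite -Es Cayley_Hamilton mul0r.
elim: s {Es} => [|c s IHs].
  by rewrite big_nil rmorph1 mul1r => /eqP; rewrite (negPf en0).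
rewrite big_cons mulrC rmorphM /= rmorphB /= horner_mx_X horner_mx_C => E.
have [|nnil] := classic (nilp (y - c *: e)); first by exists c.
apply: IHs.
have [|||w [_ _ _ uw]] := @primitive_inv e (y - c *: e) pe _ _ _ nnil.
- by rewrite rpredB ?memvZ.
- by rewrite mulrBr ey -scalerAr ee.
- by rewrite mulrBl ye -scalerAl ee.
rewrite -uw mulrA; suff -> : y - c *: e = (y - c%:M) * e by rewrite mulrA E mul0r.
by rewrite mulrBl ye -[c%:M]scalemx1 -scalerAl mul1r.
Qed.

Definition equiv_idem e f := exists x y, [/\ x \in L, y \in L, e * x = x, y * e = y &
  [/\ x * f = x, f * y = y, x * y = e & y * x = f]].

Lemma equiv_idem_sym e f : equiv_idem e f -> equiv_idem f e.
Proof. by move=> [x [y [Lx Ly ex ye [xf fy xy yx]]]]; exists y, x. Qed.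

(** [e * a * f * b * e] is invertible in [e L e], which yields [x * y = e]; then [y * x] is a
    nonzero idempotent of [f L f], hence [f]. *)
Lemma primitive_equiv e f a b : primitive e -> primitive f -> a \in L -> b \in L ->
  ~ nilp (e * a * f * b) -> equiv_idem e f.
Proof.
move=> pe [Lf ff fn0 primf] La Lb nnil; have [Le ee en0 _] := pe.
have [||||w [Lw ew we uw]] := @primitive_inv e (e * a * f * b * e) pe.
- by rewrite !LM.
- by rewrite !mulrA ee.
- by rewrite -!mulrA ee.
- by move=> /nilp_swap; rewrite !mulrA ee.
have xy : (e * a * f) * (f * b * w) = e.
  by rewrite -[RHS]uw -!mulrA ew (mulrA f f) ff.
set x := e * a * f in xy; set y := f * b * w in xy.
have ex : e * x = x by rewrite !mulrA ee.
have xf : x * f = x by rewrite -mulrA ff.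
have fy : f * y = y by rewrite !mulrA ff.
have ye : y * e = y by rewrite -mulrA we.
exists x, y; split; rewrite ?LM //; split=> //.
have [||||E|//] := primf (y * x); rewrite ?LM //.
- by rewrite mulrA -(mulrA y) xy ye.
- by rewrite mulrA fy.
- by rewrite -mulrA xf.
by case/eqP: en0; rewrite -ee -{1}xy -xy -mulrA (mulrA y) E mul0r mulr0.
Qed.

(** * The radical *)

(** The Jacobson radical, as the set of generators of nil right ideals. *)
Definition in_radical z := z \in L /\ forall a, a \in L -> nilp (z * a).

Lemma radM z a : in_radical z -> a \in L -> in_radical (z * a).
Proof.
by move=> [Lz nz] La; split=> [|b Lb]; rewrite ?LM // -mulrA; apply/nz/LM.
Qed.

Lemma rad_corner_neq e f a : primitive e -> primitive f -> a \in L ->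
  ~ equiv_idem e f -> in_radical (e * a * f).
Proof.
move=> pe pf La nef; have [Le _ _ _] := pe; have [Lf _ _ _] := pf.
split=> [|b Lb]; first by rewrite !LM.
by apply: NNPP => nnil; apply/nef/(primitive_equiv pe pf La Lb).
Qed.

(** With [c] the eigenvalue of [e * a * e], the difference [y] is nilpotent. If some [y * b] were
    not, [y] would have a right inverse in [e L e], and cancelling powers of [y] would give
    [e = 0]. *)
Lemma rad_corner_eq e a : primitive e -> a \in L ->
  exists c, in_radical (e * a * e - c *: e).
Proof.
move=> pe La; have [Le ee en0 _] := pe.
have [|||c [m Em]] := @primitive_eigenvalue e (e * a * e) pe.
- by rewrite !LM.
- by rewrite !mulrA ee.
- by rewrite -!mulrA ee.
exists c; set y := _ - _ in Em *.
have Ly : y \in L by rewrite rpredB ?memvZ ?LM.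
have ey : e * y = y by rewrite mulrBr !mulrA ee -scalerAr ee.
have ye : y * e = y by rewrite mulrBl -scalerAl -(mulrA _ e e) ee.
split=> // b Lb; apply: NNPP => nnil.
have [||||w [_ ew _ uw]] := @primitive_inv e (y * b * e) pe.
- by rewrite !LM.
- by rewrite !mulrA ey.
- by rewrite -!mulrA ee.
- by move=> /nilp_swap; rewrite !mulrA ey; apply: nnil.
have E j : y ^+ j * e = 0 -> e = 0.
  elim: j => [|j IHj]; first by rewrite mul1r.
  by rewrite exprSr -mulrA ye => E; apply: IHj; rewrite -uw !mulrA E !mul0r.
by case/eqP: en0; apply: (E m); rewrite Em mul0r.
Qed.

(** * Decomposition into primitive idempotents, by induction on the rank *)

Lemma idem_rank_lt (g h : 'M[k]_n.+1) : h * h = h -> g * h = h -> h * g = h -> h != g ->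
  (\rank h < \rank g)%N.
Proof.
move=> hh gh hg; rewrite ltnNge; apply: contra => le_gh.
have sub : (h <= g)%MS by rewrite -hg submxMl.
have /submxP[d Ed] : (g <= h)%MS by rewrite -(geq_leqif (mxrank_leqif_sup sub)).
by rewrite -[X in X == _]gh Ed -mulmxE -mulmxA mulmxE hh.
Qed.

Lemma exists_primitive g : g \in L -> g * g = g -> g != 0 ->
  exists e, [/\ primitive e, g * e = e & e * g = e].
Proof.
have [m] := ubnP (\rank g); elim: m g => // m IHm g; rewrite ltnS => le_g Lg gg gn0.
have [pg|npg] := classic (primitive g); first by exists g.
have [h [[Lh hh] [gh hg] [hn0 hng]]] : exists h, [/\ h \in L /\ h * h = h,
    g * h = h /\ h * g = h & h != 0 /\ h != g].
  apply: NNPP => nex; apply: npg; split=> // h Lh hh gh hg.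
  have [|hn0] := eqVneq h 0; first by left.
  have [|hng] := eqVneq h g; first by right.
  by case: nex; exists h.
have [||||e [pe he eh]] := IHm h => //.
  exact: leq_trans (idem_rank_lt hh gh hg hng) le_g.
exists e; split=> //; first by rewrite -he mulrA gh.
by rewrite -eh -mulrA hg.
Qed.

(* A full system of matrix units of L modulo its radical, as triples (e, x, y):
   e represents an isomorphism class of primitive idempotents, and x, y are mutually
   inverse isomorphisms between e and the summand y * x of g. *)
Definition unit_system (g : 'M[k]_n.+1) (T : seq ('M[k]_n.+1 * 'M[k]_n.+1 * 'M[k]_n.+1)) :=
  [/\ uniq T,
      forall p, p \in T -> [/\ primitive p.1.1, p.1.2 \in L, p.2 \in L,
        p.1.1 * p.1.2 = p.1.2 & p.2 * p.1.1 = p.2],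
      forall p q, p \in T -> q \in T -> p.1.2 * q.2 = if p == q then p.1.1 else 0,
      forall p q, p \in T -> q \in T -> p.1.1 = q.1.1 \/ ~ equiv_idem p.1.1 q.1.1 &
      \sum_(p <- T) p.2 * p.1.2 = g].

(** A primitive [f] is split off from [g]; the system of [g - f] is orthogonal to [f] and is
    extended by one triple for [f]. *)
Lemma exists_unit_system g : g \in L -> g * g = g -> exists T, unit_system g T.
Proof.
have [m] := ubnP (\rank g); elim: m g => // m IHm g; rewrite ltnS => le_g Lg gg.
have [->|gn0] := eqVneq g 0; first by exists [::]; split=> //; rewrite big_nil.
have [f [pf gf fg]] := exists_primitive Lg gg gn0.
have [Lf ff fn0 _] := pf.
pose g' := g - f.
have g'g' : g' * g' = g' by rewrite mulrBl !mulrBr gg ff gf fg subrr subr0.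
have gg' : g * g' = g' by rewrite mulrBr gg gf.
have g'g : g' * g = g' by rewrite mulrBl gg fg.
have fg' : f * g' = 0 by rewrite mulrBr ff fg subrr.
have g'f : g' * f = 0 by rewrite mulrBl ff gf subrr.
have [|||T [uT HT orthT eqT sumT]] := IHm g'.
- apply: leq_trans le_g; apply: idem_rank_lt => //.
  by rewrite -subr_eq0 /g' addrC addKr oppr_eq0.
- by rewrite rpredB.
- by [].
have xg' p : p \in T -> p.1.2 * g' = p.1.2.
  move=> Tp; have [_ _ _ exx _] := HT p Tp.
  rewrite -sumT mulr_sumr (bigD1_seq p) //= mulrA orthT // eqxx exx.
  rewrite big1_seq ?addr0 // => q /andP[neq Tq].
  by rewrite mulrA orthT // eq_sym (negPf neq) mul0r.
have g'y p : p \in T -> g' * p.2 = p.2.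
  move=> Tp; have [_ _ _ _ yee] := HT p Tp.
  rewrite -sumT mulr_suml (bigD1_seq p) //= -mulrA orthT // eqxx yee.
  rewrite big1_seq ?addr0 // => q /andP[neq Tq].
  by rewrite -mulrA orthT // (negPf neq) mulr0.
(* If [f] is equivalent to a representative in [T], that one is reused as [e]; otherwise [f]
   represents a new class, with [x = y = f]. *)
have [e [x [y [[pe Lx Ly] [ex ye xf fy] [xy yx] eqe]]]] : exists e x y, [/\
   [/\ primitive e, x \in L & y \in L], [/\ e * x = x, y * e = y, x * f = x & f * y = y],
   x * y = e /\ y * x = f & forall p, p \in T -> p.1.1 = e \/ ~ equiv_idem p.1.1 e].
  have [[p [Tp [x [y [Lx Ly ex ye [xf fy xy yx]]]]]]|nex] :=
      classic (exists p, p \in T /\ equiv_idem p.1.1 f).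
    exists p.1.1, x, y; split=> // [|q Tq]; last exact: eqT.
    by have [pp _ _ _ _] := HT p Tp.
  exists f, f, f; split=> // p Tp; right=> eqp.
  by apply: nex; exists p.
have en0 : e != 0 by have [] := pe.
have xy0 p : p \in T -> x * p.2 = 0.
  by move=> Tp; rewrite -xf -(g'y p Tp) mulrA -(mulrA x) fg' mulr0 mul0r.
have x0y p : p \in T -> p.1.2 * y = 0.
  by move=> Tp; rewrite -fy -(xg' p Tp) mulrA -(mulrA _ g') g'f mulr0 mul0r.
have nT : (e, x, y) \notin T.
  by apply/negP=> /xy0 /= xy1; case/eqP: en0; rewrite -xy xy1.
exists ((e, x, y) :: T); split=> [|p|p q|p q|].
- by rewrite /= nT.
- by rewrite inE => /predU1P[->|/HT].
- rewrite !inE => /predU1P[->|Tp] /predU1P[->|Tq] /=.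
  + by rewrite eqxx.
  + by rewrite xy0 //; case: eqP => // E; rewrite E Tq in nT.
  + by rewrite x0y //; case: eqP => // E; rewrite -E Tp in nT.
  + exact: orthT.
- rewrite !inE => /predU1P[->|Tp] /predU1P[->|Tq] /=.
  + by left.
  + have [->|ne] := eqe q Tq; [by left | right=> /equiv_idem_sym; exact: ne].
  + exact: eqe.
  + exact: eqT.
- by rewrite big_cons sumT /= yx addrC subrK.
Qed.

(** * Stable subspaces and a basis adapted to a composition series *)

Definition stable (W : {vspace 'rV[k]_n.+1}) :=
  forall a w, a \in L -> w \in W -> w *m a \in W.

Lemma stable_imset (U : {vspace 'rV[k]_n.+1}) (X : seq 'rV[k]_n.+1) a :
  (forall w, w \in X -> w *m a \in U) -> forall w, w \in <<X>>%VS -> w *m a \in U.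
Proof.
move=> XU w Xw; pose f := linfun (@mulmxr k 1 n.+1 n.+1 a).
have fE u : f u = u *m a by rewrite lfunE.
rewrite -fE memv_preim; apply: subvP Xw; apply/span_subvP => u Xu.
by rewrite -memv_preim fE XU.
Qed.

Lemma mulmx_rmul (v : 'rV[k]_n.+1) a b : v *m (a * b) = v *m a *m b.
Proof. by rewrite -mulmxE mulmxA. Qed.

Definition maximal_sub (W' W : {vspace 'rV[k]_n.+1}) :=
  [/\ stable W', (W' <= W)%VS & forall U, stable U -> (W' <= U <= W)%VS -> U = W' \/ U = W].

(* If v * z were outside W', then v would lie in W' + v * z * L, say v = v * z * a modulo W',
   and iterating contradicts the nilpotency of z * a. *)
Lemma rad_maximal_sub W' W v z : stable W -> maximal_sub W' W -> v \in W -> in_radical z ->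
  v *m z \in W'.
Proof.
move=> stW [stW' sW maxW'] Wv [Lz nz]; apply/idPn=> nvz.
pose f := linfun (@mulmx k 1 n.+1 n.+1 (v *m z)).
have fE a : f a = v *m z *m a by rewrite lfunE.
pose U := (W' + f @: L)%VS.
have stU : stable U.
  move=> a w La /memv_addP[w' W'w' [_ /memv_imgP[b Lb ->] ->]].
  rewrite mulmxDl memv_add ?stW' // fE -mulmx_rmul -fE memv_img //; exact: LM.
have [|EU|EU] := maxW' U stU.
- rewrite addvSl subv_add sW; apply/subvP=> _ /memv_imgP[b Lb ->].
  by rewrite fE -mulmx_rmul stW ?LM.
- case/negP: nvz; rewrite -EU; apply: (subvP (addvSr _ _)).
  by rewrite -[v *m z]mulmx1 -fE memv_img.
have /memv_addP[w W'w [_ /memv_imgP[a La ->] Ev]] : v \in U by rewrite EU.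
have [m Em] := nz a La; rewrite fE -mulmx_rmul in Ev.
have E j : v - v *m (z * a) ^+ j \in W'.
  elim: j => [|j IHj]; first by rewrite mulmx1 subrr mem0v.
  rewrite -(subrKA (v *m (z * a) ^+ j)) rpredD // exprS mulmx_rmul -mulmxBl.
  by rewrite stW' ?LX ?LM // {1}Ev addrK.
case/negP: nvz; rewrite stW' //.
by have := E m; rewrite Em mulmx0 subr0.
Qed.

Context (T : seq ('M[k]_n.+1 * 'M[k]_n.+1 * 'M[k]_n.+1)) (sysT : unit_system 1 T).

(** The product lies in [p.1.1 L q.1.1], and distinct representatives are inequivalent. *)
Lemma rad_corner p q a : p \in T -> q \in T -> a \in L ->
  exists c, in_radical (p.1.2 * a * q.2 - c *: (if p.1.1 == q.1.1 then p.1.1 else 0)).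
Proof.
move=> Tp Tq La; have [_ HT _ eqT _] := sysT.
have [pe Lxp _ exp _] := HT p Tp; have [qe _ Lyq _ yeq] := HT q Tq.
have -> : p.1.2 * a * q.2 = p.1.1 * (p.1.2 * a * q.2) * q.1.1.
  by rewrite !mulrA exp -[RHS]mulrA yeq.
have [Epq|npq] := eqVneq p.1.1 q.1.1.
  by rewrite -Epq; apply: rad_corner_eq => //; rewrite !LM.
exists 0; rewrite scaler0 subr0; apply: rad_corner_neq; rewrite ?LM //.
by case: (eqT p q Tp Tq) => // E; rewrite E eqxx in npq.
Qed.

Definition class_of e := [seq p <- T | p.1.1 == e].

Definition block_rows (w : 'rV[k]_n.+1 * 'M[k]_n.+1) := [seq w.1 *m p.1.2 | p <- class_of w.2].

Definition rows s := flatten [seq block_rows w | w <- s].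

(** One pair [(v, e)] per composition factor, the top factor first; the last clause sends [v] times
    the radical into the span of the later factors. *)
Definition adapted W s :=
  [/\ forall w, w \in s -> w.1 *m w.2 = w.1 /\ exists2 p, p \in T & w.2 = p.1.1,
      free (rows s), <<rows s>>%VS = W &
      forall i z, (i < size s)%N -> in_radical z ->
        (nth 0 s i).1 *m z \in <<rows (drop i.+1 s)>>%VS].

Lemma exists_adapted W : stable W -> exists s, adapted W s.
Proof.
have [_ HT orthT _ sumT] := sysT.
have [m] := ubnP (\dim W); elim: m W => // m IHm W; rewrite ltnS => le_W stW.
have [->|Wn0] := eqVneq W 0%VS.
  by exists [::]; split; rewrite /rows //= ?span_nil ?nil_free.
have [|W' [[stW' sW neW] maxW]] :=
    @maximal_vspace k _ (fun U => [/\ stable U, (U <= W)%VS & U != W]) 0%VS.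
  split; rewrite ?sub0v 1?eq_sym // => a w _; rewrite memv0 => /eqP->.
  by rewrite mul0mx mem0v.
have maxW' : maximal_sub W' W.
  split=> // U stU /andP[sW'U sUW]; have [->|nUW] := eqVneq U W; first by right.
  by left; apply: maxW.
have ltW : (\dim W' < \dim W)%N.
  by have [le0 eq0] := dimv_leqif_eq sW; rewrite ltn_neqAle le0 andbT eq0.
have [s [Hs freeS spanS flagS]] := IHm W' (leq_trans ltW le_W) stW'.
(* As 1 is the sum of the [p.2 * p.1.2], a [w] outside [W'] has some [w *m p.2] outside [W']; this
   is [v]. *)
have [p [v [Tp Wv W'v ve]]] : exists p v, [/\ p \in T, v \in W, v \notin W' & v *m p.1.1 = v].
  apply: NNPP => nex; case/eqP: neW; apply/eqP; rewrite eqEsubv sW; apply/subvP=> w Ww.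
  rewrite -[w]mulmx1 -[1%:M]sumT mulmx_sumr big_seq rpred_sum // => p Tp.
  have [[Le ee _ _] Lx Ly _ ye] := HT p Tp.
  rewrite mulmx_rmul stW' // -ye mulmx_rmul; apply/idPn=> nW'.
  rewrite -mulmx_rmul ye in nW'; apply: nex; exists p, (w *m p.2).
  by rewrite -mulmx_rmul ye stW.
set e := p.1.1 in ve.
have vx q : q \in T -> v *m q.1.2 \in W by move=> /HT[_ Lq _ _ _]; rewrite stW.
have vrad z : in_radical z -> v *m z \in W' by apply: rad_maximal_sub maxW' Wv.
pose X := block_rows (v, e); pose U := (<<X>> + W')%VS.
have XU q : q \in T -> q.1.1 = e -> v *m q.1.2 \in U.
  move=> Tq Eq; apply: (subvP (addvSl _ _)); apply: memv_span.
  by apply/mapP; exists q; rewrite // mem_filter Eq eqxx.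
have W'U u : u \in W' -> u \in U by apply: subvP; apply: addvSr.
have stU : stable U.
  move=> a _ La /memv_addP[u Xu [w' W'w' ->]].
  rewrite mulmxDl rpredD ?(W'U _ (stW' _ _ La W'w')) //.
  apply: stable_imset Xu => {}u /mapP[q + ->]; rewrite mem_filter => /andP[/eqP Eq Tq] /=.
  have [_ Lxq _ _ _] := HT q Tq.
  (* Inserting the decomposition of 1 after [a] leaves [q.1.2 * a * r.2]: a scalar multiple of an
     idempotent, or 0, up to a radical element that sends [v] into [W']. *)
  rewrite -[_ *m a]mulmx1 -[1%:M]sumT mulmx_sumr big_seq rpred_sum // => r Tr.
  have [_ Lxr _ exr _] := HT r Tr; have [c rc] := rad_corner Tq Tr La.
  rewrite -!mulmx_rmul !mulrA.
  rewrite -(subrK (c *: (if q.1.1 == r.1.1 then q.1.1 else 0)) (q.1.2 * a * r.2)).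
  rewrite mulrDl mulmxDr; apply: rpredD; first by apply/W'U/vrad/radM.
  case: eqP => [Eqr|_]; last by rewrite scaler0 mul0r mulmx0 mem0v.
  by rewrite -scalerAl -scalemxAr rpredZ // Eqr exr XU // -Eqr.
have EU : U = W.
  have [_ _ onlyW] := maxW'; have [|EU|//] := onlyW U stU.
    rewrite addvSr subv_add sW andbT; apply/span_subvP=> u /mapP[q + ->].
    by rewrite mem_filter => /andP[_ Tq]; apply: vx.
  have [_ _ Ly _ _] := HT p Tp; case/negP: W'v; rewrite -EU -ve.
  by have := orthT p p Tp Tp; rewrite eqxx -/e => <-; rewrite mulmx_rmul stU ?XU.
exists ((v, e) :: s); split.
- by move=> u; rewrite inE => /predU1P[->|/Hs] //; split=> //; exists p.
- rewrite /rows /= -/(rows s) /block_rows /=.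
  have : uniq (class_of e) by rewrite filter_uniq //; case: sysT.
  have : {subset class_of e <= class_of e} by [].
  elim: {1 3 4}(class_of e) => //= q B IHB sB /andP[nBq uB].
  have := sB q (mem_head _ _); rewrite mem_filter => /andP[/eqP Eq Tq].
  rewrite free_cons IHB ?andbT //; last by move=> r Br; rewrite sB // inE Br orbT.
  (* Multiplication by [q.2] turns [v *m q.1.2] into [v], kills the other rows of this block and
     keeps those of [s] inside [W']; a dependence would put [v] into [W']. *)
  apply/negP=> /stable_imset sp; case/negP: W'v.
  rewrite -ve -Eq; have := orthT q q Tq Tq; rewrite eqxx => <-; rewrite mulmx_rmul.
  apply: sp => u; rewrite mem_cat => /orP[/mapP[r Br ->]|su].
    have := sB r; rewrite inE Br orbT => /(_ isT); rewrite mem_filter => /andP[_ Tr].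
    rewrite -mulmx_rmul orthT //; case: eqP => [E|_]; last by rewrite mulmx0 mem0v.
    by rewrite -E Br in nBq.
  have [_ _ Ly _ _] := HT q Tq.
  by rewrite stW' // -spanS memv_span.
- by rewrite /rows /= -/(rows s) span_cat spanS.
- by move=> [|i] z lti rz; [rewrite /= drop0 spanS vrad | apply: flagS].
Qed.

(** * Conjugating the algebra into the adapted basis *)

Context (s : seq ('rV[k]_n.+1 * 'M[k]_n.+1)) (adS : adapted fullv s).

Definition vec_of (i : 'I_(size s)) := (nth 0 s i).1.
Definition idem_of (i : 'I_(size s)) := (nth 0 s i).2.
Definition block_size i := size (class_of (idem_of i)).

Lemma sum_block_size : (\sum_i block_size i)%N = n.+1.
Proof.
have [_ freeS spanS _] := adS.
have := eqP freeS; rewrite spanS dimvf /dim /= mul1n => /esym sz; apply: etrans sz.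
rewrite size_flatten /shape -map_comp sumnE big_map (big_nth 0) big_mkord.
by apply: eq_bigr => i _; rewrite /= size_map.
Qed.

Notation bl := (blk sum_block_size).
Notation po := (pos sum_block_size).
Definition elt r := nth 0 (class_of (idem_of (bl r))) (po r).
Definition eqv_block i j := idem_of i == idem_of j.

Lemma eqv_block_sym i j : eqv_block i j -> eqv_block j i.
Proof. by rewrite /eqv_block eq_sym. Qed.

Lemma eqv_block_trans i j l : eqv_block i j -> eqv_block j l -> eqv_block i l.
Proof. by move=> /eqP Eij /eqP Ejl; rewrite /eqv_block Eij Ejl. Qed.

Lemma mem_elt r : elt r \in class_of (idem_of (bl r)).
Proof. by rewrite mem_nth ?pos_lt. Qed.

Lemma elt_in r : elt r \in T.
Proof. by have := mem_elt r; rewrite mem_filter => /andP[]. Qed.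

Lemma elt_idem r : (elt r).1.1 = idem_of (bl r).
Proof. by have := mem_elt r; rewrite mem_filter => /andP[/eqP]. Qed.

Lemma uniq_class e : uniq (class_of e).
Proof. by case: sysT => uT _ _ _ _; rewrite filter_uniq. Qed.

(** Equivalent blocks share one repetition-free list [class_of], and a triple determines its
    idempotent. *)
Lemma same_elt r r' : same sum_block_size eqv_block r r' = (elt r == elt r').
Proof.
apply/andP/eqP => [[/eqP Ei /eqP Ep]|E]; first by rewrite /elt Ei Ep.
have Ei : idem_of (bl r) = idem_of (bl r') by rewrite -!elt_idem E.
rewrite /eqv_block Ei eqxx; split=> //.
move/eqP: E; rewrite /elt Ei nth_uniq ?uniq_class //; last exact: pos_lt.
by rewrite -Ei; apply: pos_lt.
Qed.

Lemma vec_idem i : vec_of i *m idem_of i = vec_of i.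
Proof. by have [Hs _ _ _] := adS; have [] := Hs (nth 0 s i) (mem_nth 0 (ltn_ord i)). Qed.

Lemma index_elt i p : p \in T -> p.1.1 = idem_of i -> exists r, bl r = i /\ elt r = p.
Proof.
move=> Tp Ep; have cp : p \in class_of (idem_of i) by rewrite mem_filter Ep eqxx.
have lt : (index p (class_of (idem_of i)) < block_size i)%N by rewrite index_mem.
have [r [br pr]] := index_of sum_block_size lt.
by exists r; split; rewrite // /elt br pr nth_index.
Qed.

Definition basis_mx : 'M[k]_n.+1 := \matrix_r (vec_of (bl r) *m (elt r).1.2).
Notation Q := basis_mx.

Lemma row_basis_mx r : row r Q = vec_of (bl r) *m (elt r).1.2.
Proof. exact: rowK. Qed.

Lemma rowsP m u : u \in rows (drop m s) -> exists r, (m <= bl r)%N /\ u = row r Q.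
Proof.
case/flattenP=> _ /mapP[w /(nthP 0)[j ltj <-] ->] /mapP[p + ->].
rewrite nth_drop mem_filter => /andP[/eqP Ep Tp].
rewrite size_drop ltn_subRL in ltj.
have [r [br er]] := @index_elt (Ordinal ltj) p Tp Ep.
by exists r; rewrite row_basis_mx er br leq_addr.
Qed.

Lemma basis_mx_unit : Q \in unitmx.
Proof.
rewrite -row_full_unit -sub1mx; apply/row_subP=> i.
have [_ _ spanS _] := adS.
have : row i 1%:M \in <<rows (drop 0 s)>>%VS by rewrite drop0 spanS memvf.
move=> /(@coord_span _ _ _ (in_tuple _)) ->; apply: summx_sub => j _; apply: scalemx_sub.
by have [|r [_ ->]] := @rowsP 0 (rows (drop 0 s))`_j; rewrite ?mem_nth ?row_sub.
Qed.

(** [u *m invmx Q] is the coordinate row of [u] in the new basis; this is the source of block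
    triangularity. *)
Lemma coord_rows m u c : u \in <<rows (drop m s)>>%VS -> (bl c < m)%N ->
  (u *m invmx Q) 0 c = 0.
Proof.
move=> /(@coord_span _ _ _ (in_tuple _)) -> ltc.
rewrite mulmx_suml summxE big1 // => j _; rewrite -scalemxAl mxE.
have [|r [ltm ->]] := @rowsP m (rows (drop m s))`_j; first by rewrite mem_nth.
rewrite -row_mul mulmxV ?basis_mx_unit // !mxE.
by case: eqP => [E|_]; rewrite ?mulr0 //; rewrite E leqNgt ltc in ltm.
Qed.

Lemma conj_term r c q a c0 : q \in T -> (bl c <= bl r)%N ->
  in_radical ((elt r).1.2 * a * q.2 -
         c0 *: (if (elt r).1.1 == q.1.1 then (elt r).1.1 else 0)) ->
  (vec_of (bl r) *m ((elt r).1.2 * a * q.2 * q.1.2) *m invmx Q) 0 c =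
    if (bl c == bl r) && (q == elt c) then c0 else 0.
Proof.
move=> Tq le_cr; set E := if _ then _ else _; set z := _ - _ => radz.
have [_ HT _ _ _] := sysT; have [_ Lx _ ex _] := HT q Tq.
have -> : (elt r).1.2 * a * q.2 = z + c0 *: E by rewrite subrK.
(* The radical part lands strictly after block [bl r], so it vanishes at [c] even when
   [bl c = bl r]. *)
rewrite mulrDl mulmxDr mulmxDl mxE (@coord_rows (bl r).+1) ?add0r //; last first.
  have [_ _ _ flagS] := adS; apply: flagS; [exact: ltn_ord | exact: radM].
rewrite -scalerAl -scalemxAr -scalemxAl mxE /E; case: eqP => [Epq|npq].
  have [r' [br' er']] := @index_elt (bl r) q Tq (etrans (esym Epq) (elt_idem r)).
  rewrite elt_idem mulmx_rmul vec_idem -br' -er' -row_basis_mx -row_mul mulmxV ?basis_mx_unit //.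
  rewrite !mxE; suff -> : (r' == c) = (bl c == bl r') && (elt r' == elt c).
    by case: ifP; rewrite ?mulr1 ?mulr0.
  apply/eqP/andP=> [->|[/eqP Eb]]; first by rewrite !eqxx.
  by rewrite -same_elt => /andP[_ /eqP Ep]; apply: blk_pos_inj Ep.
rewrite mul0r mulmx0 mul0mx mxE mulr0.
case: ifP => // /andP[/eqP Eb /eqP Eq].
by case: npq; rewrite Eq !elt_idem Eb.
Qed.

Lemma conj_entry r c a : (Q *m a *m invmx Q) r c =
  \sum_(q <- T) (vec_of (bl r) *m ((elt r).1.2 * a * q.2 * q.1.2) *m invmx Q) 0 c.
Proof.
have [_ _ _ _ sumT] := sysT.
rewrite -summxE -mulmx_suml -mulmx_sumr.
under eq_bigr do rewrite -mulrA.
rewrite -mulr_sumr sumT mulr1 mulmx_rmul -row_basis_mx -!row_mul.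
by rewrite [RHS]mxE.
Qed.

Lemma conj_triangular a : a \in L ->
  block_triangular sum_block_size eqv_block (Q *m a *m invmx Q).
Proof.
move=> La; have [uT _ _ _ _] := sysT.
have radE r q : q \in T -> exists c0, in_radical ((elt r).1.2 * a * q.2 -
         c0 *: (if (elt r).1.1 == q.1.1 then (elt r).1.1 else 0)).
  by move=> Tq; apply: (rad_corner (elt_in r) Tq La).
(* A diagonal-block entry is a scalar determined by [a], [elt r] and [elt c] alone, so it agrees
   across equivalent blocks. *)
have diag r c c0 : bl r = bl c -> in_radical ((elt r).1.2 * a * (elt c).2 -
      c0 *: (if (elt r).1.1 == (elt c).1.1 then (elt r).1.1 else 0)) ->
    (Q *m a *m invmx Q) r c = c0.
  move=> Eb rz; have le_cr : (bl c <= bl r)%N by rewrite Eb.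
  rewrite conj_entry (bigD1_seq (elt c)) ?elt_in //=.
  rewrite (conj_term _ le_cr rz) ?elt_in // Eb !eqxx big1_seq ?addr0 // => q /andP[nq Tq].
  have [c1 rq] := radE r q Tq.
  by rewrite -Eb (conj_term _ le_cr rq) // (negPf nq) andbF.
split=> [r c lt_cr|r c r' c' Eb Eb'].
  rewrite conj_entry big1_seq // => q /= Tq; have [c1 rq] := radE r q Tq.
  by rewrite (conj_term _ _ rq) 1?ltnW // -val_eqE ltn_eqF.
rewrite !same_elt => /eqP Er /eqP Ec; have [c0 rc] := radE r (elt c) (elt_in c).
by rewrite (diag r c c0) // (diag r' c' c0) // -Er -Ec.
Qed.

(** After multiplication by [Q], row [r'] of either side is the basis row with triple [elt c] in the
    block of [r'] if [elt r' = elt r], and 0 otherwise. *)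
Lemma conj_unit r c : eqv_block (bl r) (bl c) ->
  unit_mx k sum_block_size eqv_block r c = Q *m ((elt r).2 * (elt c).1.2) *m invmx Q.
Proof.
move=> e_rc; have [_ HT orthT _ _] := sysT.
apply: (canRL (mulmxK basis_mx_unit)); apply/row_matrixP=> r'.
rewrite [in RHS]row_mul row_basis_mx -mulmx_rmul mulrA orthT ?elt_in // -same_elt.
apply/rowP=> j; rewrite mxE; case: ifP => [srr'|/negbT nsrr']; last first.
  by rewrite unit_mul0 // mul0r mulmx0 mxE.
have /andP[/eqP err' _] := srr'.
have [_ _ _ ex _] := HT _ (elt_in c).
have Ec : (elt c).1.1 = idem_of (bl r') by rewrite elt_idem err' (eqP e_rc).
have [s' [bs es]] := index_elt (elt_in c) Ec.
have ps : po s' = po c.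
  by have : same sum_block_size eqv_block s' c by [rewrite same_elt es]; case/andP=> _ /eqP.
rewrite (unit_mul eqv_block_sym eqv_block_trans _ _ _ bs ps); last first.
  by rewrite /eqv_block eq_sym.
by rewrite srr' elt_idem -Ec ex -es -bs -row_basis_mx [RHS]mxE.
Qed.

Lemma reduced_conj : exists P : 'M[k]_n.+1, P \in unitmx /\
  reduced_matrix_algebra (fun B => exists A, A \in L /\ B = invmx P *m A *m P).
Proof.
(* The basis vectors are the rows of [Q], so [a] has matrix [Q *m a *m invmx Q] in this basis. *)
exists (invmx Q); split; first by rewrite unitmx_inv basis_mx_unit.
rewrite invmxK; exists (size s), block_size, eqv_block.
apply: (reduced_of_corner_spaces (Hn := sum_block_size)).
- by move=> i; rewrite /eqv_block.
- exact: eqv_block_sym.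
- exact: eqv_block_trans.
- by move=> i j /eqP Eij; rewrite /block_size Eij.
- by exists 0; rewrite mem0v mulmx0 mul0mx.
- move=> _ _ [A [LA ->]] [B [LB ->]]; exists (A + B).
  by rewrite rpredD // mulmxDr mulmxDl.
- by move=> c _ [A [LA ->]]; exists (c *: A); rewrite rpredZ // -scalemxAr -scalemxAl.
- move=> _ _ [A [LA ->]] [B [LB ->]]; exists (A * B); rewrite LM //; split=> //.
  by rewrite -mulmxE !mulmxA mulmxKV ?basis_mx_unit.
- have [_ HT _ _ _] := sysT => r c erc; exists ((elt r).2 * (elt c).1.2); rewrite conj_unit //.
  have [_ _ Ly _ _] := HT _ (elt_in r); have [_ Lx _ _ _] := HT _ (elt_in c).
  by rewrite LM.
- by move=> _ [A [LA ->]]; apply: conj_triangular.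
Qed.

End MatrixAlgebra.

Theorem theorem1p1 (k : closedFieldType) (n : nat) (L : 'M[k]_n -> Prop) :
  matrix_algebra L ->
  exists P : 'M[k]_n, P \in unitmx /\
    reduced_matrix_algebra (fun B : 'M[k]_n => exists A, L A /\ B = invmx P *m A *m P).
Proof.
case: n L => [|n] L [L0 LD LZ LM L1].
  (* Size 0, where matrices do not form a nonzero ring, is settled with no blocks and no
     equations. *)
  exists 1%:M; split; first exact: unitmx1.
  exists 0%N, (fun=> 0%N), (fun _ _ => true), [::].
  split; first by rewrite big_ord0.
  do 4!split=> //; split=> [_|_]; first by split=> [[]|[]|].
  by exists 0; split; rewrite // [S]flatmx0 [RHS]flatmx0.
have [U UE] := vspace_of_pred L0 LD LZ.
have U1 : 1 \in U by apply/UE.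
have UM a b : a \in U -> b \in U -> a * b \in U.
  by move=> /UE La /UE Lb; apply/UE/LM.
have [T sysT] := exists_unit_system U1 (mulr1 1).
have stV : stable U fullv by move=> *; apply: memvf.
have [s adS] := exists_adapted U1 UM sysT stV.
have [P [uP [t [ns [eqv [eqs [sum_ns [er [es [et [ens redP]]]]]]]]]]] :=
  reduced_conj U1 UM sysT adS.
exists P; split=> //; exists t, ns, eqv, eqs; do 5!split=> //.
move=> S; rewrite -redP.
by split=> [[A [/UE LA ->]]|[A [/UE LA ->]]]; exists A.
Qed.
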